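(* Let $r\ge 3$ and $0\le m\le n$ be integers. Let $G$ be any $n$-vertex graph and let $M\subset V(G)$ contain $m$ vertices, such that no copy of $K_r$ in $G$ intersects $M$. Then (a) $e(G)\le t_{r-1}(n,m)$, and (b) if $e(G)=t_{r-1}(n,m)$ then $G\in\mathcal{T}_{r-1}(n,m)$.
   Context: $T_{r-1}(n)$ denotes the Turán graph, the complete $(r-1)$-partite graph on $n$ vertices with part sizes differing by at most one, and $t_{r-1}(n)$ denotes its number of edges. Define $t_{r-1}(n,m)=t_{r-1}(n)$ if $n\le (r-1)m$, and $t_{r-1}(n,m)=\binom{n}{2}-nm+(r-1)\binom{m+1}{2}$ if $n>(r-1)m$. The family $\mathcal{T}_{r-1}(n,m)$ is defined as follows. If $n\le (r-1)m$, then $\mathcal{T}_{r-1}(n,m)=\{T_{r-1}(n)\}$. If $n>(r-1)m$: start with $T_{r-1}((r-1)m)$ with colour classes $V_1,\dots,V_{r-1}$ and an arbitrary set $M$ of $m$ vertices in $V_1\cup\dots\cup V_{r-1}$. Add $r-1$ new vertices $v_1,\dots,v_{r-1}$ (called sporadic), where $v_i$ is adjacent to all old and new vertices except those in $V_i$ (and itself). Then add a set $Y$ of $n-(r-1)m$ new vertices, each adjacent to all old and new vertices except those in $M$ (and itself). Call the resulting $(n+r-1)$-vertex graph $G_r(n,M)$. Then $\mathcal{T}_{r-1}(n,m)$ is the family of $n$-vertex graphs obtainable from some graph $G_r(n,M)$ (for some placement of $M$) by deleting any $r-1$ vertices from $\{v_1,\dots,v_{r-1}\}\cup Y$. *)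

(* Defs.v *)
From mathcomp Require Import all_boot.

Set Implicit Arguments.
Unset Strict Implicit.
Unset Printing Implicit Defensive.

Record sgraph := SGraph {
  vertex :> finType;
  adj : rel vertex;
  adj_sym : symmetric adj;
  adj_irrefl : irreflexive adj }.

Definition num_edges (G : sgraph) : nat :=
  #|[set E : {set G} | [exists x, exists y, adj x y && (E == [set x; y])]]|.

Definition clique (G : sgraph) (K : {set G}) : bool :=
  [forall x in K, forall y in K, (x != y) ==> adj x y].

Definition isomorphic (G H : sgraph) : Prop :=
  exists2 f : G -> H, bijective f & forall x y, adj (f x) (f y) = adj x y.

Section Induced.
Variables (G : sgraph) (S : {set G}).

Definition induced_adj : rel {x : G | x \in S} :=
  fun u v => adj (val u) (val v).

Lemma induced_sym : symmetric induced_adj.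
Proof. by move=> u v; apply: adj_sym. Qed.

Lemma induced_irrefl : irreflexive induced_adj.
Proof. by move=> u; apply: adj_irrefl. Qed.

Definition induced : sgraph := SGraph induced_sym induced_irrefl.
End Induced.

Definition delete (G : sgraph) (D : {set G}) : sgraph := induced (~: D).

(* The colour classes are the residue classes modulo k, whose sizes differ    *)
(* by at most one (turan_balanced).                                           *)
Section Turan.
Variables (k n : nat).

Definition turan_adj : rel 'I_n := fun x y => x %% k != y %% k.

Lemma turan_sym : symmetric turan_adj.
Proof. by move=> x y; rewrite /turan_adj eq_sym. Qed.

Lemma turan_irrefl : irreflexive turan_adj.
Proof. by move=> x; rewrite /turan_adj eqxx. Qed.

Definition turan_graph : sgraph := SGraph turan_sym turan_irrefl.

Definition turan_class (i : 'I_k) : {set turan_graph} :=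
  [set x : 'I_n | x %% k == i].

End Turan.

Lemma card_turan_class (k n : nat) (i : 'I_k) :
  #|turan_class n i| = n %/ k + (i < n %% k).
Proof.
have k0 : 0 < k := leq_ltn_trans (leq0n i) (ltn_ord i).
rewrite cardsE -sum1_card big_mkcond /=.
under eq_bigr do rewrite unfold_in /=.
elim: n => [|n IHn]; first by rewrite big_ord0 div0n mod0n.
rewrite big_ord_recr /= IHn -[eqn _ _]/(n %% k == i).
have mk : n %% k < k by rewrite ltn_mod.
have [e|ne] := eqVneq (n %% k).+1 k.
  have -> : n.+1 = (n %/ k).+1 * k by rewrite {1}(divn_eq n k) -addnS e mulSnr.
  rewrite mulnK // modnMl ltn0 addn0 -addnA -[RHS]addn1; congr (_ + _).
  have : i <= n %% k by rewrite -ltnS e.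
  rewrite leq_eqVlt eq_sym.
  by case: eqP => [->|_] /=; [rewrite ltnn | move->].
have lt : (n %% k).+1 < k by rewrite ltn_neqAle ne.
have -> : n.+1 = n %/ k * k + (n %% k).+1 by rewrite addnS -divn_eq.
rewrite divnMDl // modnMDl (divn_small lt) (modn_small lt) addn0 -addnA.
congr (_ + _); rewrite ltnS (leq_eqVlt i) [(i : nat) == _]eq_sym.
by case: eqP => [->|_] /=; rewrite ?ltnn ?addn0.
Qed.

Lemma turan_balanced (k n : nat) (i j : 'I_k) :
  #|turan_class n i| <= #|turan_class n j|.+1.
Proof.
by rewrite !card_turan_class -addnS leq_add2l; case: (_ < _); case: (_ < _).
Qed.

Definition turan_number (k n : nat) : nat := num_edges (turan_graph k n).

(* The subtraction is on nat, but it never truncates for k >= 2: there        *)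
(* k * m < n gives 2 * m <= n - 1, hence n * m <= 'C(n, 2).                   *)
Definition turan_bound (k n m : nat) : nat :=
  if n <= k * m then turan_number k n
  else 'C(n, 2) - n * m + k * 'C(m.+1, 2).

(* The graph G_r(n, M) for k = r - 1. Its vertices are the vertices of        *)
(* T_k(k m), tagged Old, the sporadic vertices v_i, and those of the set Y.   *)
Notation Old x := (inl (inl x)).
Notation Sporadic i := (inl (inr i)).
Notation InY y := (inr y).

Section Extension.
Variables (k n m : nat) (M : {set turan_graph k (k * m)}).

Definition ext_vertex : finType :=
  (turan_graph k (k * m) + 'I_k + 'I_(n - k * m))%type.

Definition ext_adj : rel ext_vertex := fun u v =>
  match u, v with
  | Old x, Old y => adj x y
  | Old x, Sporadic i | Sporadic i, Old x => x \notin turan_class (k * m) i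
  | Sporadic i, Sporadic j => i != j
  | Old x, InY _ | InY _, Old x => x \notin M
  | Sporadic _, InY _ | InY _, Sporadic _ => true
  | InY y, InY z => y != z
  end.

Lemma ext_sym : symmetric ext_adj.
Proof.
move=> [[x|i]|y] [[x'|j]|z];
  first [done | exact: adj_sym | by congr (~~ _); apply: eq_sym].
Qed.

Lemma ext_irrefl : irreflexive ext_adj.
Proof. move=> [[x|i]|y];
  first [exact: adj_irrefl | by apply/negbF; apply: eqxx]. Qed.

Definition ext_graph : sgraph := SGraph ext_sym ext_irrefl.

Definition deletable : {set ext_graph} :=
  [set u : ext_vertex | if u is Old _ then false else true].
End Extension.

(* Membership is up to isomorphism. *)
Definition turan_family (k n m : nat) (G : sgraph) : Prop :=
  if n <= k * m then isomorphic G (turan_graph k n)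
  else exists (M : {set turan_graph k (k * m)}) (D : {set ext_graph n M}),
    [/\ #|M| = m, D \subset deletable n M, #|D| = k & isomorphic G (delete D)].

(* Main.v *)
(* Write k = r - 1 and count nonadjacent pairs, by deleting one vertex at a
   time. If n >= km and every vertex outside M misses fewer than m others,
   while some u in M misses fewer than n - km + m - 1, then starting from u one
   can greedily pick k - 1 vertices outside M and one last vertex, which gives
   a K_r through u. So some vertex has many non-neighbours, and deleting it
   (and shrinking M) proves the bound by induction. For n <= km the bound for M
   follows from that for a subset of M of size n / k.

   In the case of equality, n > km forces a vertex b outside M with exactly m
   non-neighbours, and G - b is again extremal. If G - b has the required
   structure, the non-neighbours of b are either M (so b joins Y) or a whole
   class of size m (so b is the sporadic vertex of that class), for otherwise b
   would lie in a K_r with one vertex from each class, one of them in M. If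
   n = km, every vertex has exactly m - 1 non-neighbours, and nonadjacency
   turns out to be an equivalence relation with k classes. *)
Require Import Defs.
From mathcomp Require Import all_boot.
From mathcomp Require Import zify.

Set Implicit Arguments.
Unset Strict Implicit.
Unset Printing Implicit Defensive.

(** * Counting nonadjacent pairs, and the lower bound on their number *)

Section Nonadjacency.
Variable G : sgraph.
Implicit Types (S M K Q : {set G}) (x y u b : G).

(* Contains x itself when x is in S. *)
Definition non_nbrs S x : {set G} := [set y in S | ~~ adj x y].

(* Twice the number of nonadjacent pairs inside S, plus #|S|. *)
Definition non_weight S : nat := \sum_(x in S) #|non_nbrs S x|.

Definition common_nbrs S Q : {set G} := [set y in S | [forall x in Q, adj x y]].

Definition no_clique_meets k M : Prop :=
  forall K, clique K -> #|K| = k.+1 -> [disjoint K & M].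

Lemma no_clique_meetsS k M M' :
  M' \subset M -> no_clique_meets k M -> no_clique_meets k M'.
Proof.
by move=> sM nK K cK kK; apply: disjointWr sM _; apply: nK.
Qed.

Lemma cliqueP K :
  reflect {in K &, forall x y, x != y -> adj x y} (clique K).
Proof.
apply: (iffP forall_inP) => [h x y xK yK|h x xK].
  by move/forall_inP: (h x xK) => /(_ y yK) /implyP.
by apply/forall_inP => y yK; apply/implyP; apply: h.
Qed.

Lemma clique_setU1 K x :
  clique K -> {in K, forall y, adj x y} -> clique (x |: K).
Proof.
move=> /cliqueP cK xK; apply/cliqueP => y z.
rewrite !in_setU1 => /orP[/eqP->|yK] /orP[/eqP->|zK] yz.
- by rewrite eqxx in yz.
- exact: xK.
- by rewrite adj_sym; apply: xK.
- exact: cK.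
Qed.

Lemma adj_neq x y : adj x y -> x != y.
Proof. by apply: contraTneq => ->; rewrite adj_irrefl. Qed.

Lemma non_nbrs_self S x : x \in S -> x \in non_nbrs S x.
Proof. by move=> xS; rewrite inE xS adj_irrefl. Qed.

Lemma card_non_nbrs_gt0 S x : x \in S -> 0 < #|non_nbrs S x|.
Proof. by move=> xS; apply/card_gt0P; exists x; apply: non_nbrs_self. Qed.

(** Deleting [x] removes its row and its entry in the row of each non-neighbour; the [.+1] is there
    because [x] paired with itself lies in both. *)
Lemma non_weight_del S x :
  x \in S -> (non_weight S).+1 = non_weight (S :\ x) + 2 * #|non_nbrs S x|.
Proof.
move=> xS; rewrite /non_weight (big_setD1 x) //=.
have split_x y : #|non_nbrs S y| = #|non_nbrs (S :\ x) y| + ~~ adj x y.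
  rewrite (cardsD1 x) inE xS [adj y x]adj_sym addnC; congr (_ + _).
  by apply: eq_card => z; rewrite !inE andbA.
under eq_bigr do rewrite split_x.
rewrite big_split /=.
have -> : \sum_(y in S :\ x) ~~ adj x y = #|non_nbrs (S :\ x) x|.
  rewrite -sum1_card [RHS]big_mkcond [LHS]big_mkcond /=; apply: eq_bigr => y _.
  by rewrite [in RHS]inE; case: (y \in _) => //=; case: (adj x y).
rewrite split_x adj_irrefl; lia.
Qed.

(* As long as at most k - 1 vertices outside M have been chosen, the common
   neighbourhood has at least #|M| vertices; since it misses u, it is not
   contained in M. *)
Lemma greedy_clique k S M u :
    u \in M -> M \subset S -> {in S :\: M, forall b, #|non_nbrs S b| <= #|M|} ->
    #|non_nbrs S u| + k * #|M| <= #|S| ->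
  exists Q, [/\ clique Q, #|Q| = k.+1, u \in Q, Q \subset S &
    #|S| <= #|non_nbrs S u| + k * #|M| + #|common_nbrs S Q|].
Proof.
move=> uM /subsetP sMS degB; elim: k => [|k IHk] le_kS.
  exists [set u]; rewrite cards1 set11 sub1set (sMS u uM); split=> //.
    by apply/cliqueP => x y; rewrite !inE => /eqP-> /eqP->; rewrite eqxx.
  rewrite mul0n addn0 -(cardsID (non_nbrs S u) S).
  apply: leq_add; apply: subset_leq_card; apply/subsetP => y; rewrite !inE.
    by case/andP=> _.
  case/andP; rewrite negb_and negbK => /orP[/negP nyS /nyS //|uy] ->.
  by apply/forall_inP => x; rewrite inE => /eqP->.
have [|Q [cQ kQ uQ sQS le_S]] := IHk; first by lia.
have [b bQ bM] : exists2 b, b \in common_nbrs S Q & b \notin M.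
  apply/subsetPn; apply/negP => sQM.
  have /subset_leq_card : common_nbrs S Q \subset M :\ u.
    apply/subsetP => y yQ; rewrite in_setD1 (subsetP sQM) // andbT.
    move: yQ; rewrite inE => /andP[_ /forall_inP /(_ u uQ)] /adj_neq.
    by rewrite eq_sym.
  have := cardsD1 u M; rewrite uM; lia.
move: (bQ); rewrite inE => /andP[bS /forall_inP bQ'].
exists (b |: Q); split.
- by apply: clique_setU1 => // y yQ; rewrite adj_sym bQ'.
- rewrite cardsU1 kQ; case: (boolP (b \in Q)) => // /bQ'.
  by rewrite adj_irrefl.
- by rewrite !inE uQ orbT.
- by rewrite subUset sub1set bS.
- have := degB b; rewrite inE bM bS => /(_ isT) degb.
  suff : #|common_nbrs S Q| <= #|non_nbrs S b| + #|common_nbrs S (b |: Q)|.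
    by lia.
  rewrite -(cardsID (non_nbrs S b) (common_nbrs S Q)).
  apply: leq_add; apply: subset_leq_card; apply/subsetP => y; rewrite !inE.
    by case/andP=> _.
  case/andP => + /andP[yS /forall_inP yQ]; rewrite yS /= negbK => yb.
  by apply/forall_inP => x; rewrite !inE => /orP[/eqP->|/yQ].
Qed.

(** With [num_edges_non_weight] this becomes the edge bound for [k * #|M| <= #|S|]. In the
    induction, deleting a vertex alone suffices if its [non_nbrs] has more than [#|M|] elements; if
    [#|M|] drops too, [#|S| + #|M| - k * #|M|] elements suffice. *)
Lemma non_weight_lb k S M :
    0 < k -> no_clique_meets k M -> M \subset S -> k * #|M| <= #|S| ->
  2 * #|S| * #|M| + #|S| <= non_weight S + k * #|M| * #|M|.+1.
Proof.
move=> k_gt0; move: {2}#|S| (erefl #|S|) => n; elim: n S M => [|n IHn] S M cS.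
  by rewrite cS muln0 mul0n.
move=> nK sMS kM; have [->|[u uM]] := set_0Vmem M.
  rewrite cards0 !muln0 add0n addn0 -sum1_card.
  by apply: leq_sum => x; apply: card_non_nbrs_gt0.
have uS := subsetP sMS _ uM.
have := cardsD1 u M; rewrite uM => cM.
have cSD x : x \in S -> #|S :\ x| = n.
  by move=> xS; have := cardsD1 x S; rewrite xS cS; lia.
have kn : k * #|M :\ u| <= n by nia.
have nKu : no_clique_meets k (M :\ u).
  by apply: no_clique_meetsS nK; apply: subD1set.
have [bdeg|] := boolP [exists b in S :\: M, #|M| < #|non_nbrs S b|].
  have /exists_inP[b] := bdeg; rewrite inE => /andP[bM bS] degb.
  have wt := non_weight_del bS.
  have [lt_kM|ge_kM] := ltnP (k * #|M|) #|S|.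
    have := IHn (S :\ b) M (cSD b bS) nK.
    rewrite subsetD1 sMS bM cSD // => /(_ isT); rewrite cS in lt_kM *; nia.
  (* Here [#|S| = k * #|M|], so [M] has to shrink along with [S]. *)
  have := IHn (S :\ b) (M :\ u) (cSD b bS) nKu.
  rewrite subsetD1 (subset_trans (subD1set _ _) sMS) cSD //.
  rewrite !inE (negPf bM) andbF => /(_ isT kn).
  have : #|S| = k * #|M| by lia.
  rewrite cS; move: wt degb; rewrite cM; nia.
rewrite negb_exists => /forallP degB.
have {}degB : {in S :\: M, forall b, #|non_nbrs S b| <= #|M|}.
  by move=> b bS; have := degB b; rewrite bS /= -leqNgt.
have [degu|degu] := leqP (#|S| + #|M|) (#|non_nbrs S u| + k * #|M|).
  have := IHn (S :\ u) (M :\ u) (cSD u uS) nKu (setSD _ sMS).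
  rewrite cSD // => /(_ kn); have := non_weight_del uS.
  move: degu; rewrite cS cM; nia.
case: k k_gt0 nK kM {IHn kn nKu} degu => // k _ nK _ degu.
(* [k] now denotes the predecessor of the original one. The clique [Q] still has a common neighbour,
   which may lie in [M], and adding it gives a forbidden clique. *)
have [|Q [cQ kQ uQ sQS le_S]] := greedy_clique (k := k) uM sMS degB.
  by lia.
have /card_gt0P[y] : 0 < #|common_nbrs S Q| by lia.
rewrite inE => /andP[yS /forall_inP yQ].
have : clique (y |: Q) by apply: clique_setU1 => // x /yQ; rewrite adj_sym.
have yNQ : y \notin Q by apply/negP => /yQ; rewrite adj_irrefl.
move/nK; rewrite cardsU1 yNQ kQ => /(_ erefl) /pred0P /(_ u).
by rewrite /= uM !inE uQ orbT.
Qed.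

End Nonadjacency.

(** * The structure of extremal pairs *)

Section Extremal.
Variables (G : sgraph) (k : nat).
Hypothesis k_gt0 : 0 < k.
Implicit Types (S M K Q : {set G}) (x y u b : G) (c : G -> option 'I_k).

(** The last equation is the case of equality in [non_weight_lb]. *)
Definition extremal S M : Prop :=
  [/\ no_clique_meets k M, M \subset S, k * #|M| <= #|S| &
      non_weight S + k * #|M| * #|M|.+1 = 2 * #|S| * #|M| + #|S|].

Definition class_of S c (i : 'I_k) : {set G} := [set x in S | c x == Some i].

(* The i-th class is V_i, possibly together with the sporadic vertex v_i; the
   vertices coloured None are those of Y. *)
Definition structured S M c : Prop :=
  [/\ {in M, forall x, c x != None},
      forall i, #|M| <= #|class_of S c i| <= #|M|.+1 &
      {in S &, forall x y, adj x y =
        match c x, c y with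
        | Some i, Some j => i != j
        | None, None => x != y
        | Some _, None => x \notin M
        | None, Some _ => y \notin M
        end}].

(** The condition [x \notin M :\ u] covers both [x = u] and [x] outside [M]. Compared with the
    equality for an extremal pair, this bound caps the number of non-neighbours of [x]. *)
Lemma non_weight_lb_del S M u x :
    no_clique_meets k M -> M \subset S -> k * #|M| <= #|S| ->
    u \in M -> x \in S -> x \notin M :\ u ->
  2 * #|S|.-1 * #|M|.-1 + #|S|.-1
    <= non_weight (S :\ x) + k * #|M|.-1 * #|M|.
Proof.
move=> nK sMS kM uM xS xM.
have := cardsD1 u M; have := cardsD1 x S; rewrite uM xS => cS cM.
have cMu : #|M :\ u| = #|M|.-1 by lia.
have cSx : #|S :\ x| = #|S|.-1 by lia.
have := @non_weight_lb G k (S :\ x) (M :\ u) k_gt0.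
have m_gt0 : #|M|.-1.+1 = #|M| by lia.
rewrite cMu cSx m_gt0; apply.
- by apply: no_clique_meetsS nK; apply: subD1set.
- by rewrite subsetD1 xM (subset_trans (subD1set _ _) sMS).
- by nia.
Qed.

Lemma extremal_nbrs_in S M u : extremal S M -> u \in M ->
  #|non_nbrs S u| + k * #|M| <= #|S| + #|M|.
Proof.
move=> [nK sMS kM eqN] uM; have uS := subsetP sMS _ uM.
have uMu : u \notin M :\ u by rewrite !inE eqxx.
have := non_weight_lb_del nK sMS kM uM uS uMu.
have := non_weight_del uS.
have : 0 < #|M| by apply/card_gt0P; exists u.
have : 0 < #|S| by apply/card_gt0P; exists u.
move: eqN kM; nia.
Qed.

(** The strict inequality leaves room to delete [b] without shrinking [M]. *)
Lemma extremal_nbrs_out S M b :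
    extremal S M -> k * #|M| < #|S| -> b \in S -> b \notin M ->
  #|non_nbrs S b| <= #|M|.+1.
Proof.
move=> [nK sMS _ eqN] kM bS bM.
have := cardsD1 b S; rewrite bS => cS.
have := @non_weight_lb G k (S :\ b) M k_gt0 nK.
rewrite subsetD1 sMS bM => /(_ isT).
have := non_weight_del bS.
move: eqN kM; nia.
Qed.

(** Deletion shows that each size is at most [#|M|], and equality in the bound makes their average
    [#|M|]. *)
Lemma extremal_nbrs_balanced S M :
    extremal S M -> #|S| = k * #|M| -> {in S, forall x, #|non_nbrs S x| = #|M|}.
Proof.
move=> ex cS; have [nK sMS kM eqN] := ex.
have le_m x : x \in S -> #|non_nbrs S x| <= #|M|.
  move=> xS; have [xM|xM] := boolP (x \in M).
    by have := extremal_nbrs_in ex xM; lia.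
  have S_gt0 : 0 < #|S| by apply/card_gt0P; exists x.
  have /card_gt0P[u uM] : 0 < #|M| by nia.
  have xMu : x \notin M :\ u by rewrite !inE (negPf xM) andbF.
  have := non_weight_lb_del nK sMS kM uM xS xMu.
  have := non_weight_del xS.
  move: eqN kM; nia.
have sum_m : \sum_(x in S) #|non_nbrs S x| = \sum_(x in S) #|M|.
  by rewrite sum_nat_const -/(non_weight S); move: eqN; nia.
have [_] := leqif_sum (fun x xS => leqif_eq (le_m x xS)).
by rewrite sum_m eqxx => /esym/forall_inP h x /h/eqP.
Qed.

(** A vertex adjacent to all of [Q] would give a forbidden clique through [u], so the sets
    [non_nbrs S q] cover [S]; their sizes add up to [k * #|M| = #|S|], so they partition it. *)
Lemma extremal_partition S M Q u :
    extremal S M -> #|S| = k * #|M| -> u \in M ->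
    clique Q -> #|Q| = k -> u \in Q -> Q \subset S ->
  {in S, forall x, #|[set q in Q | x \in non_nbrs S q]| = 1}.
Proof.
move=> ex cS uM cQ kQ uQ /subsetP sQS; have [nK _ _ _] := ex.
have ge1 x : x \in S -> 1 <= #|[set q in Q | x \in non_nbrs S q]|.
  move=> xS; rewrite card_gt0; apply: contraT; rewrite negbK => /eqP/setP noq.
  have xQ : {in Q, forall q, adj x q}.
    move=> q qQ; have := noq q; rewrite !inE qQ xS /= adj_sym.
    by move/negbFE.
  have xNQ : x \notin Q by apply/negP => /xQ; rewrite adj_irrefl.
  have := nK _ (clique_setU1 cQ xQ).
  rewrite cardsU1 xNQ kQ => /(_ erefl) /pred0P /(_ u).
  by rewrite /= uM !inE uQ orbT.
have sum1 :
    \sum_(x in S) 1 = \sum_(x in S) #|[set q in Q | x \in non_nbrs S q]|.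
  transitivity (\sum_(q in Q) #|non_nbrs S q|).
    rewrite sum1_card cS -kQ -sum_nat_const; apply: eq_bigr => q /sQS qS.
    by rewrite (extremal_nbrs_balanced ex cS).
  under eq_bigr do rewrite -sum1_card.
  rewrite (exchange_big_dep (mem S)) /=; last first.
    by move=> q x _; rewrite inE; case/andP.
  apply: eq_bigr => x xS; rewrite -sum1_card; apply: eq_bigl => q.
  by rewrite [in RHS]inE.
have [_] := leqif_sum (fun x xS => leqif_eq (ge1 x xS)).
by rewrite -sum1 eqxx => /esym/forall_inP h x /h/eqP <-.
Qed.

(** The classes are the sets [non_nbrs S q] for [q] in a [k]-clique [Q] through some [u] in [M]. The
    main point is that each vertex has the same non-neighbours as its representative in [Q]. *)
Lemma extremal_structured_balanced S M :
  extremal S M -> #|S| = k * #|M| -> exists c, structured S M c.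
Proof.
move=> ex cS; have [nK sMS kM _] := ex.
have bal := extremal_nbrs_balanced ex cS.
have [M0|[u uM]] := set_0Vmem M.
  have S0 : S = set0 by apply/eqP; rewrite -cards_eq0 cS M0 cards0 muln0.
  exists (fun=> None); split=> [x|i|x y]; rewrite ?M0 ?S0 ?inE //.
  have -> : class_of set0 (fun=> None) i = set0.
    by apply/setP => x; rewrite !inE.
  by rewrite cards0.
have uS := subsetP sMS _ uM.
have [Q [cQ kQ uQ sQS]] :
    exists Q, [/\ clique Q, #|Q| = k, u \in Q & Q \subset S].
  have [||Q [cQ kQ uQ sQS _]] := greedy_clique (k := k.-1) uM sMS.
  - by move=> b; rewrite inE => /andP[_ /bal->].
  - by rewrite bal // cS -{2}(prednK k_gt0) mulSn.
  - by exists Q; rewrite kQ prednK.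
have part := extremal_partition ex cS uM cQ kQ uQ sQS.
(* The default [u] is used only outside [S]. *)
pose rep x := odflt u [pick q in Q | x \in non_nbrs S q].
have repP x : x \in S -> rep x \in Q /\ x \in non_nbrs S (rep x).
  move=> xS; rewrite /rep; case: pickP => [q /andP[]//|noq].
  have /eqP/cards1P[q /setP/(_ q)] := part x xS.
  by rewrite in_set set11; have := noq q; rewrite /= => ->.
have rep_uniq x q : q \in Q -> x \in non_nbrs S q -> rep x = q.
  move=> qQ xq; have xS : x \in S by move: xq; rewrite inE => /andP[].
  have [rQ xr] := repP x xS.
  have /eqP/cards1P[p /setP ep] := part x xS.
  have := ep q; rewrite in_set qQ xq in_set1 => /esym/eqP->.
  by have := ep (rep x); rewrite in_set rQ xr in_set1 => /esym/eqP->.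
have sCS x : {subset non_nbrs S x <= S} by move=> y; rewrite inE => /andP[].
have sQS' := subsetP sQS.
have repS x : x \in S -> rep x \in S by move=> /repP[/sQS'].
(* Replacing [rep x] by [x] in [Q] gives another [k]-clique through [u]; comparing the two
   partitions yields the equality. *)
have eq_nbrs_off x : x \in S -> rep x != u -> non_nbrs S x = non_nbrs S (rep x).
  move=> xS xu; have [rQ xr] := repP x xS.
  have adjx q : q \in Q -> q != rep x -> adj x q.
    move=> qQ qr; rewrite adj_sym; apply: contraR qr => nqx; apply/eqP/esym.
    by apply: rep_uniq; rewrite // inE xS.
  apply/esym/eqP; rewrite eqEcard !bal ?repS // leqnn andbT.
  apply/subsetP => y yr; have yS := sCS _ _ yr.
  pose Q' := x |: Q :\ rep x.
  have xNQ : x \notin Q :\ rep x.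
    by rewrite !inE; apply/negP => /andP[xr' /adjx/(_ xr')]; rewrite adj_irrefl.
  have cQ' : clique Q'.
    apply: clique_setU1 => [|q]; last by rewrite !inE => /andP[qr /adjx]; apply.
    apply/cliqueP => p q; rewrite !inE => /andP[_ pQ] /andP[_ qQ].
    exact: (cliqueP _ cQ).
  have kQ' : #|Q'| = k.
    by have := cardsD1 (rep x) Q; rewrite rQ /Q' cardsU1 xNQ kQ.
  have uQ' : u \in Q' by rewrite !inE uQ [u == rep x]eq_sym xu orbT.
  have sQ' : Q' \subset S.
    by rewrite subUset sub1set xS (subset_trans (subD1set _ _)).
  have := extremal_partition ex cS uM cQ' kQ' uQ' sQ' yS.
  move/eqP/cards1P => [q /setP/(_ q)].
  rewrite [in RHS]inE eqxx inE => /andP[]; rewrite in_setU1 => /orP[/eqP->//|].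
  rewrite in_setD1 => /andP[qr qQ] /(rep_uniq _ _ qQ) yq.
  by rewrite -yq (rep_uniq y (rep x)) ?eqxx in qr.
(* If [rep x = u], the swap would lose [u]. Instead, a non-neighbour [y] of [x] with [rep y != u]
   has the non-neighbours of [rep y], so [x] would share that representative. *)
have eq_nbrs x : x \in S -> non_nbrs S x = non_nbrs S (rep x).
  move=> xS; have [xu|/(eq_nbrs_off _ xS)//] := eqVneq (rep x) u.
  have [rQ xr] := repP x xS.
  apply/eqP; rewrite eqEcard !bal ?repS // leqnn andbT.
  apply/subsetP => y yx; have yS := sCS _ _ yx; have [rQy yr] := repP y yS.
  have [yu|/(eq_nbrs_off _ yS) ey] := eqVneq (rep y) u; first by rewrite xu -yu.
  have xy : x \in non_nbrs S y by move: yx; rewrite !inE xS adj_sym; case/andP.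
  by move: xy; rewrite ey => /(rep_uniq _ _ rQy) ->.
pose idx x : 'I_k := cast_ord kQ (enum_rank_in uQ (rep x)).
have idx_eq x y : x \in S -> y \in S -> (idx x == idx y) = (rep x == rep y).
  move=> /repP[xQ _] /repP[yQ _]; apply/eqP/eqP => [/cast_ord_inj|e].
    by move/enum_rank_in_inj; apply.
  by rewrite /idx e.
exists (Some \o idx); split=> // [i|x y xS yS] /=.
  pose q := enum_val (cast_ord (esym kQ) i).
  have qQ : q \in Q := enum_valP _.
  have rq : rep q = q.
    by apply: rep_uniq => //; apply: non_nbrs_self; apply: sQS'.
  have qS := sQS' _ qQ.
  have iq : idx q = i by rewrite /idx rq enum_valK_in cast_ordKV.
  suff -> : class_of S (Some \o idx) i = non_nbrs S q.
    by rewrite bal // leqnn /=.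
  apply/setP => x; rewrite inE /=.
  apply/andP/idP => [[xS /eqP[]]|xq].
    rewrite -iq => /eqP; rewrite idx_eq // rq => /eqP <-.
    by have [] := repP x xS.
  split; first exact: sCS xq.
  have xS := sCS _ _ xq; rewrite -iq; apply/eqP; congr Some; apply/eqP.
  by rewrite idx_eq // rq (rep_uniq x q).
rewrite idx_eq //.
have -> : adj x y = (y \notin non_nbrs S x) by rewrite inE yS negbK.
congr (~~ _); rewrite eq_nbrs //; have [rQx xr] := repP x xS.
have [rQy yr] := repP y yS.
by apply/idP/eqP => [/(rep_uniq _ _ rQx)->|->].
Qed.

(** The forbidden clique in the form used below: one vertex per index and an apex [b]. Adjacency
    alone makes these [k.+1] vertices distinct. *)
Lemma no_clique_family M (p : 'I_k -> G) b :
    no_clique_meets k M -> (forall i j, i != j -> adj (p i) (p j)) ->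
    (forall i, adj b (p i)) -> b \notin M /\ forall i, p i \notin M.
Proof.
move=> nK pp bp.
have p_inj : injective p.
  by move=> i j e; apply/eqP; apply: contraT => /pp; rewrite e adj_irrefl.
have cK : clique (b |: [set p i | i in 'I_k]).
  apply: clique_setU1 => [|x /imsetP[i _ ->]//].
  apply/cliqueP => x y /imsetP[i _ ->] /imsetP[j _ ->].
  by rewrite (inj_eq p_inj); apply: pp.
have bNp : b \notin [set p i | i in 'I_k].
  by apply/negP => /imsetP[i _ e]; have := bp i; rewrite -e adj_irrefl.
have := nK _ cK; rewrite cardsU1 bNp card_imset // card_ord => /(_ erefl).
move=> dK; split=> [|i]; apply: (contraTN _ dK) => xM; apply/pred0Pn.
  by exists b; rewrite /= !inE eqxx.
by exists (p i); rewrite /= xM !inE imset_f ?orbT.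
Qed.

Lemma structured_extend_Y S M c b :
    b \in S -> b \notin M -> M \subset S -> structured (S :\ b) M c ->
    non_nbrs S b = b |: M ->
  structured S M (fun x => if x == b then None else c x).
Proof.
move=> bS bM sMS [cM sz adjc] eb.
have nb x : x \in M -> (x == b) = false.
  by move=> xM; apply: contraNF bM => /eqP<-.
have adjb x : x \in S -> x != b -> adj b x = (x \notin M).
  move=> xS xb; have := congr1 (fun A : {set G} => x \in A) eb.
  by rewrite !inE xS (negPf xb) /= => <-; rewrite negbK.
split=> [x xM|i|x y xS yS]; first by rewrite nb // cM.
  suff -> : class_of S (fun x => if x == b then None else c x) i
          = class_of (S :\ b) c i by [].
  by apply/setP => x; rewrite !inE; have [->|xb] := eqVneq x b; rewrite ?andbF.
have [->|xb] := eqVneq x b; have [->|yb] := eqVneq y b.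
- by rewrite adj_irrefl /= ?eqxx.
- rewrite adjb //; case: (c y) (cM y) => [l|] // cMy.
  by apply/negP => /cMy.
- rewrite adj_sym adjb //; case: (c x) (cM x) => [l|] // cMx.
  by rewrite xb; apply/negP => /cMx.
- by apply: adjc; rewrite !inE ?xb ?yb.
Qed.

(** Class [j] has no sporadic vertex yet, so it can take [b] within the size bound; [b \notin M]
    matches the adjacency of [b] to [Y]. *)
Lemma structured_extend_class S M c b (j : 'I_k) :
    b \in S -> b \notin M -> M \subset S -> structured (S :\ b) M c ->
    #|class_of (S :\ b) c j| = #|M| ->
    non_nbrs S b = b |: class_of (S :\ b) c j ->
  structured S M (fun x => if x == b then Some j else c x).
Proof.
move=> bS bM sMS [cM sz adjc] cj eb.
have nb x : x \in M -> (x == b) = false.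
  by move=> xM; apply: contraNF bM => /eqP<-.
have adjb x : x \in S -> x != b -> adj b x = (c x != Some j).
  move=> xS xb; have := congr1 (fun A : {set G} => x \in A) eb.
  by rewrite !inE xS (negPf xb) /= => <-; rewrite negbK.
split=> [x xM|i|x y xS yS]; first by rewrite nb // cM.
  have [<-|ij] := eqVneq j i.
    suff -> : class_of S (fun x => if x == b then Some j else c x) j
            = b |: class_of (S :\ b) c j.
      by rewrite cardsU1 cj !inE eqxx /= leqnSn leqnn.
    apply/setP => x; rewrite !inE; have [->|xb] //= := eqVneq x b.
    by rewrite bS eqxx.
  suff -> : class_of S (fun x => if x == b then Some j else c x) i
          = class_of (S :\ b) c i by [].
  apply/setP => x; rewrite !inE; have [->|xb] //= := eqVneq x b.
  by apply/negbTE; apply: contra ij => /andP[_ /eqP[->]].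
have [->|xb] := eqVneq x b; have [->|yb] := eqVneq y b.
- by rewrite adj_irrefl /= ?eqxx.
- rewrite adjb //; case: (c y) => [l|]; last by rewrite bM.
  by rewrite eq_sym; congr (~~ _); apply/eqP/eqP => [[]|->].
- rewrite adj_sym adjb //; case: (c x) => [l|]; last by rewrite bM.
  by congr (~~ _); apply/eqP/eqP => [[]|->].
- by apply: adjc; rewrite !inE ?xb ?yb.
Qed.

Lemma extremal_structured S M : extremal S M -> exists c, structured S M c.
Proof.
move: {2}#|S| (erefl #|S|) => n; elim: n S => [|n IHn] S cS ex.
  apply: extremal_structured_balanced => //.
  by case: ex => _ _ kM _; move: kM; rewrite cS leqn0 => /eqP->.
have [nK sMS kM eqN] := ex.
have [eq_kM|neq_kM] := eqVneq #|S| (k * #|M|).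
  exact: extremal_structured_balanced.
have lt_kM : k * #|M| < #|S| by rewrite ltn_neqAle eq_sym neq_kM.
(* If no such [b] existed, [extremal_nbrs_in] would give [non_weight S] at most
   [2 * #|S| * #|M| - k * #|M| ^ 2], which is [#|S| - k * #|M| > 0] less than its value. *)
have [b bSM degb] : exists2 b, b \in S :\: M & #|M| < #|non_nbrs S b|.
  apply/exists_inP; apply: contraT; rewrite negb_exists => /forallP nb.
  have le_out : \sum_(x in S :\: M) #|non_nbrs S x| <= (#|S| - #|M|) * #|M|.
    have -> : #|S| - #|M| = #|S :\: M| by rewrite cardsD (setIidPr sMS).
    rewrite -sum_nat_const; apply: leq_sum => x xSM.
    by have := nb x; rewrite xSM /= -leqNgt.
  have le_in : \sum_(x in M) #|non_nbrs S x| <= #|M| * (#|S| + #|M| - k * #|M|).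
    rewrite -sum_nat_const; apply: leq_sum => x xM.
    by have := extremal_nbrs_in ex xM; lia.
  have : non_weight S = \sum_(x in M) #|non_nbrs S x|
                      + \sum_(x in S :\: M) #|non_nbrs S x|.
    by rewrite /non_weight (big_setID M) /= (setIidPr sMS).
  have := subset_leq_card sMS; move: eqN lt_kM le_in le_out.
  set A := \sum_(x in M) _; set B := \sum_(x in _) _.
  move: #|S| #|M| (non_weight S) => s m N eqN lt_kM le_in le_out le_ms eqAB.
  (* Two expressions for [s] replace the truncated subtractions, after which the products are atoms
     for linear arithmetic. *)
  have [t et] : exists t, s = m + t by exists (s - m); lia.
  have [d ed] : exists d, s = k * m + d by exists (s - k * m); lia.
  have le_in' : A <= m * (d + m) by have <- : s + m - k * m = d + m by lia.
  have le_out' : B <= t * m by move: le_out; rewrite et addKn.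
  have sm : s * m = m * m + t * m by rewrite et mulnDl.
  have skm : s * m = k * m * m + m * d by rewrite {1}ed mulnDl [d * m]mulnC.
  rewrite mulnDr in le_in'; move: eqN; rewrite mulnS -mulnA.
  lia.
have [bM bS] : b \notin M /\ b \in S by move: bSM; rewrite inE => /andP.
have {}degb : #|non_nbrs S b| = #|M|.+1.
  by apply/eqP; rewrite eqn_leq degb extremal_nbrs_out.
have cSb : #|S :\ b| = n by have := cardsD1 b S; rewrite bS cS; lia.
(* Exactly [#|M|.+1] non-neighbours, [b] included, preserve equality in the bound. *)
have [|c strc] := IHn (S :\ b) cSb.
  split; rewrite // ?subsetD1 ?sMS //; first by rewrite cSb; lia.
  have := non_weight_del bS; move: eqN; rewrite degb cSb cS; nia.
have [cM sz adjc] := strc.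
pose X := non_nbrs S b :\ b.
have bnb : b \in non_nbrs S b := non_nbrs_self bS.
have eX : non_nbrs S b = b |: X by rewrite setD1K.
have cX : #|X| = #|M|.
  by have := cardsD1 b (non_nbrs S b); rewrite bnb degb -/X; lia.
have [eXM|] := eqVneq M X.
  eexists; apply: structured_extend_Y strc _ => //; by rewrite eX -eXM.
rewrite eqEcard cX leqnn andbT => /subsetPn[z zM zX].
have := cM z zM; case cz : (c z) => [i|] // _.
(* [z] is a vertex of [M] adjacent to [b]. If no class lay inside [X], then [z], a neighbour of [b]
   from each other class, and [b] would form a forbidden clique. *)
suff [j sj] : exists j, class_of (S :\ b) c j \subset X.
  have ej : class_of (S :\ b) c j = X.
    by apply/eqP; rewrite eqEcard sj cX; case/andP: (sz j).
  by eexists; apply: (structured_extend_class (j := j)) strc _ _; rewrite ?ej.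
apply/existsP; apply: contraT; rewrite negb_exists => /forallP nsub.
pose p j := if j == i then z else
  odflt z [pick w in class_of (S :\ b) c j :\: X].
have zS : z \in S :\ b.
  rewrite !inE (subsetP sMS) // andbT.
  by apply: contraNneq bM => <-.
have pP j : p j \in class_of (S :\ b) c j :\: X.
  rewrite /p; case: eqP => [->|_].
    by rewrite in_setD zX in_set zS cz eqxx.
  case: pickP => //= no; have /subsetPn[w wj wX] := nsub j.
  by have := no w; rewrite in_setD wj wX.
have pS j : [/\ p j \in S :\ b, c (p j) = Some j & p j \notin X].
  have := pP j; rewrite in_setD => /andP[->].
  by rewrite /class_of in_set => /andP[-> /eqP->].
have [||_ /(_ i)] := @no_clique_family M p b nK.
- move=> j l jl; have [Sj cj _] := pS j; have [Sl cl _] := pS l.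
  by rewrite adjc // cj cl.
- move=> j; have [] := pS j; rewrite !inE => /andP[-> ->] _ /=.
  by rewrite negbK.
- by rewrite /p eqxx zM.
Qed.

End Extremal.

(** * Edge counts, and the weight of the Turan graph *)

(** Both sides count ordered adjacent pairs; the fibre over an edge consists of its two
    orientations. *)
Lemma sum_card_nbrs (G : sgraph) :
  \sum_(x : G) #|[set y | adj x y]| = 2 * num_edges G.
Proof.
transitivity (\sum_(p : G * G | adj p.1 p.2) 1).
  rewrite -(pair_big_dep xpredT (fun x y : G => adj x y) (fun _ _ => 1)) /=.
  by apply: eq_bigr => x _; rewrite sum1_card cardsE.
pose edges :=
  [set E : {set G} | [exists x, exists y, adj x y && (E == [set x; y])]].
rewrite (partition_big (fun p => [set p.1; p.2]) (mem edges)) /=; last first.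
  by move=> [x y] /= xy; rewrite inE; apply/existsP; exists x; apply/existsP;
     exists y; rewrite xy eqxx.
rewrite mulnC -sum_nat_const; apply: eq_bigr => E.
rewrite inE => /existsP[x /existsP[y /andP[xy /eqP->]]].
have xy' := adj_neq xy.
have <- : #|[set (x, y); (y, x)]| = 2.
  by rewrite cards2; congr (_.+1); rewrite xpair_eqE negb_and xy'.
rewrite -sum1_card; apply: eq_bigl => -[u v]; rewrite !inE !xpair_eqE /=.
apply/andP/orP => [[uv /eqP e]|[]/andP[/eqP-> /eqP->]]; last 2 first.
- by rewrite xy eqxx.
- by rewrite adj_sym xy setUC eqxx.
have := adj_neq uv.
have : u \in [set x; y] by rewrite -e !inE eqxx.
have : v \in [set x; y] by rewrite -e !inE eqxx orbT.
rewrite !inE => /orP[]/eqP-> /orP[]/eqP->; rewrite ?eqxx //; by auto.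
Qed.

Lemma num_edges_non_weight (G : sgraph) :
  2 * num_edges G + non_weight [set: G] = #|G| ^ 2.
Proof.
rewrite -sum_card_nbrs /non_weight [X in _ + X](eq_bigl xpredT); last first.
  by move=> x; rewrite inE.
rewrite -big_split /= -mulnn -sum_nat_const; apply: eq_bigr => x _.
rewrite -(cardsC [set y | adj x y]); congr (_ + _).
by apply: eq_card => y; rewrite !inE.
Qed.

(** A class contributes the square of its size, and [n %% k] classes have one vertex more than
    [n %/ k]. *)
Lemma turan_non_weight k n : 0 < k ->
  non_weight [set: turan_graph k n]
    = k * (n %/ k) ^ 2 + n %% k * (2 * (n %/ k)).+1.
Proof.
move=> k_gt0; pose cl (x : 'I_n) := Ordinal (ltn_pmod x k_gt0).
rewrite /non_weight (partition_big (cl : turan_graph k n -> 'I_k) xpredT) //=.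
transitivity (\sum_(i < k) ((n %/ k) ^ 2 + (i < n %% k) * (2 * (n %/ k)).+1)).
  apply: eq_bigr => i _.
  have mem_class (x : turan_graph k n) : (x \in turan_class n i) = (cl x == i).
    by rewrite inE.
  transitivity (\sum_(x in turan_class n i) #|turan_class n i|).
    apply: eq_big => [x|x]; first by rewrite mem_class inE.
    rewrite inE => /eqP <-; apply: eq_card => y; rewrite !inE /= negbK.
    by rewrite eq_sym.
  rewrite sum_nat_const card_turan_class; case: (_ < _); rewrite -mulnn; nia.
rewrite big_split /= sum_nat_const card_ord -big_distrl /=; congr (_ + _ * _).
have le_sk : n %% k <= k by rewrite ltnW // ltn_mod.
rewrite -[RHS](card_ord (n %% k)) -sum1_card (big_ord_widen _ (fun=> 1) le_sk).
by rewrite [RHS]big_mkcond; apply: eq_bigr => i _; case: (_ < _).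
Qed.

Lemma subset_of_card (T : finType) (A : {set T}) q :
  q <= #|A| -> exists2 B : {set T}, B \subset A & #|B| = q.
Proof.
move=> le_q; exists [set x in take q (enum A)].
  by apply/subsetP => x; rewrite inE => /mem_take; rewrite mem_enum.
rewrite cardsE (card_uniqP _) ?take_uniq ?enum_uniq //.
by rewrite size_takel // -cardE.
Qed.

Lemma bin2_double n : 2 * 'C(n, 2) + n = n ^ 2.
Proof. by elim: n => // n IHn; rewrite binS bin1; nia. Qed.

(** * Isomorphisms with the Turan graph and with members of the family *)

Section Isomorphisms.
Variables (G : sgraph) (k q : nat).
Implicit Types (M : {set G}) (x y w b : G).

Definition balanced_colouring (c : G -> 'I_k) : Prop :=
  (forall i, q <= #|[set x | c x == i]| <= q.+1) /\
  forall x y, adj x y = (c x != c y).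

Lemma card_classes (c : G -> option 'I_k) :
  #|G| = \sum_(i < k) #|class_of [set: G] c i| + #|[set x | c x == None]|.
Proof.
rewrite -[LHS]sum1_card (bigID (fun x => c x == None)) /= addnC.
congr (_ + _); last first.
  by rewrite sum1_card cardsE.
case: (posnP k) => [k0|k_gt0].
  rewrite !big1 // => [[i lt_ik] _|x]; first by exfalso; rewrite k0 in lt_ik.
  by case: (c x) => // -[i lt_ik]; exfalso; rewrite k0 in lt_ik.
rewrite (partition_big (fun x => odflt (Ordinal k_gt0) (c x)) xpredT) //=.
apply: eq_bigr => i _; rewrite -sum1_card; apply: eq_bigl => x.
by rewrite !inE /=; case: (c x).
Qed.

(* A vertex of M outside M' leaves at most one vertex in Y, and then only if M'
   is a whole class, which that vertex completes. *)
Lemma structured_balanced M M' (c : G -> option 'I_k) :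
    1 < k -> no_clique_meets k M -> M' \subset M -> #|M'| = q ->
    structured [set: G] M' c -> #|G| %/ k = q ->
    (k * q < #|G| -> exists2 w, w \in M & w \notin M') ->
  exists c', balanced_colouring c'.
Proof.
move=> k_gt1 nK sM'M cM' [cM sz adjc] eq_q ex_w.
have k_gt0 : 0 < k by apply: ltnW.
have {}adjc x y := adjc x y (in_setT x) (in_setT y).
have in_class x i : (x \in class_of [set: G] c i) = (c x == Some i).
  by rewrite !inE.
(* For [q = 0] the graph is complete on fewer than [k] vertices, and each vertex gets its own
   class. *)
have [q0|q_gt0] := posnP q.
  have lt_Gk : #|G| < k by rewrite ltnNge -divn_gt0 // eq_q q0.
  have M'0 : M' = set0 by apply/eqP; rewrite -cards_eq0 cM' q0.
  exists (fun x => widen_ord (ltnW lt_Gk) (enum_rank x)).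
  have inj : injective (fun x => widen_ord (ltnW lt_Gk) (enum_rank x)).
    by move=> x y /(congr1 val) /= /val_inj /enum_rank_inj.
  split=> [i|x y].
    rewrite q0 /=; apply/card_le1_eqP => x y; rewrite !inE => /eqP <- /eqP e.
    exact: inj.
  rewrite (inj_eq inj); have [->|xy] := eqVneq x y; first by rewrite adj_irrefl.
  rewrite adjc M'0; case cx: (c x) => [i|]; case cy: (c y) => [j|];
    rewrite ?inE ?xy //.
  apply: contra xy => /eqP ij; apply/eqP.
  have /andP[_] := sz i; rewrite cM' q0 => /card_le1_eqP; apply;
    by rewrite in_class ?cx ?cy ij.
have [None0|[y yN]] := set_0Vmem [set x | c x == None].
  have cS x : exists i, c x = Some i.
    case cx : (c x) => [i|]; first by exists i.
    by have := in_set0 x; rewrite -None0 inE cx.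
  have [c' c'P] := fin_all_exists cS.
  exists c'; split=> [i|x z]; last by rewrite adjc !c'P.
  rewrite -cM' (_ : [set x | _] = class_of [set: G] c i) //.
  by apply/setP => x; rewrite in_class c'P inE.
have [|w wM wM'] := ex_w.
  rewrite (card_classes c) -addn1; apply: leq_add; last first.
    by apply/card_gt0P; exists y.
  have -> : k * q = \sum_(i < k) q by rewrite sum_nat_const card_ord.
  by apply: leq_sum => i _; rewrite -cM'; case/andP: (sz i).
have {yN}cy : c y = None by move: yN; rewrite inE => /eqP.
(* Otherwise every class has a vertex outside [M']. Taking [w] in its own class with apex [y], or
   [w] as apex if it is uncoloured, gives a forbidden clique through [w]. *)
have [j sj] : exists j, class_of [set: G] c j \subset M'.
  apply/existsP; apply: contraT; rewrite negb_exists => /forallP nsub.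
  pose p j := if c w == Some j then w else
    odflt w [pick v in class_of [set: G] c j :\: M'].
  have pP j : p j \in class_of [set: G] c j :\: M'.
    rewrite /p; case: eqP => [cw|_].
      by rewrite in_setD wM' in_class cw eqxx.
    case: pickP => //= no; have /subsetPn[v vj vM] := nsub j.
    by have := no v; rewrite in_setD vj vM.
  have pS j : c (p j) = Some j /\ p j \notin M'.
    by have := pP j; rewrite in_setD in_class => /andP[-> /eqP->].
  pose b := if c w == None then w else y.
  have cb : c b = None by rewrite /b; case: eqP.
  have [||bM pM] := no_clique_family (p := p) (b := b) nK.
  - move=> i j ij; have [ci _] := pS i; have [cj _] := pS j.
    by rewrite adjc ci cj.
  - by move=> i; have [ci pi] := pS i; rewrite adjc cb ci.
  case cw : (c w) => [i|].
    by have := pM i; rewrite /p cw eqxx wM.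
  by have := bM; rewrite /b cw eqxx wM.
have ej : class_of [set: G] c j = M'.
  by apply/eqP; rewrite eqEcard sj; case/andP: (sz j).
have notM' x i : c x = Some i -> i != j -> x \notin M'.
  by move=> cx ij; rewrite -ej in_class cx; apply: contra ij => /eqP[->].
(* Uncoloured vertices are adjacent to each other and to all classes but [j], which is [M']; a
   second one could replace class [j] in a forbidden clique through [w]. *)
have y_uniq y' : c y' = None -> y' = y.
  move=> cy'; apply/eqP; apply: contraT => yy'.
  have nonempty i : exists x, c x = Some i.
    have /andP[ge_q _] := sz i.
    have /card_gt0P[x] : 0 < #|class_of [set: G] c i| by lia.
    by rewrite in_class => /eqP; exists x.
  have [v vP] := fin_all_exists nonempty.
  pose b := if c w == None then w else y.
  have cb : c b = None by rewrite /b; case: eqP.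
  pose p l := if l == j then (if b == y then y' else y)
    else if c w == Some l then w else v l.
  have pj : c (p j) = None /\ b != p j.
    rewrite /p eqxx; case: (eqVneq b y) => [->|by_]; split=> //.
    by rewrite eq_sym.
  have pl l : l != j -> c (p l) = Some l.
    by rewrite /p => /negPf->; case: eqP.
  have [||bM pM] := no_clique_family (p := p) (b := b) nK.
  - move=> i l; rewrite adjc; have [cpj _] := pj.
    have [->|ij] := eqVneq i j; have [->|lj] := eqVneq l j;
      rewrite ?cpj ?eqxx // => il.
    + by rewrite (pl l lj) (notM' _ l) ?pl.
    + by rewrite (pl i ij) (notM' _ i) ?pl.
    + by rewrite !pl.
  - move=> l; have [->|lj] := eqVneq l j.
      by have [cpj bpj] := pj; rewrite adjc cb cpj.
    by rewrite adjc cb pl // (notM' _ l) ?pl.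
  case cw : (c w) => [i|].
    have ij : i != j.
      by apply: contraNneq wM' => ij; rewrite -ej in_class cw ij.
    by have := pM i; rewrite /p (negPf ij) cw eqxx wM.
  by have := bM; rewrite /b cw eqxx wM.
have yM' : y \notin M' by apply/negP => /cM; rewrite cy.
(* Only [y] receives the default [j]; its non-neighbours other than itself are exactly [M'], which
   is class [j]. *)
exists (fun x => odflt j (c x)); split=> [i|x z].
  have [->|ij] := eqVneq i j.
    suff -> : [set x | odflt j (c x) == j] = y |: M'.
      by rewrite cardsU1 yM' cM' leqnSn leqnn.
    apply/setP => x; rewrite !inE -ej in_class.
    case cx: (c x) => [l|] /=; last by rewrite (y_uniq x) ?eqxx.
    by case: (eqVneq x y) => // xy; rewrite xy cy in cx.
  rewrite -cM'.
  suff -> : [set x | odflt j (c x) == i] = class_of [set: G] c i by [].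
  apply/setP => x; rewrite in_class inE; case: (c x) => //=.
  by rewrite eq_sym (negPf ij).
rewrite adjc; case cx: (c x) => [i|]; case cz: (c z) => [l|] //=.
- by rewrite -ej in_class cx.
- by rewrite -ej in_class cz [j == l]eq_sym.
- by rewrite (y_uniq x cx) (y_uniq z cz) !eqxx.
Qed.

(** Counting from 0, vertex [t] of class [l] in the list [L] goes to [t * k + l]. Classes of size
    [q.+1] come first in [L], so that their last vertices fill the values from [q * k] on. *)
Lemma balanced_turan c :
  0 < k -> balanced_colouring c -> isomorphic G (turan_graph k #|G|).
Proof.
move=> k_gt0 [sz adjc].
pose cl i := [set x | c x == i]; pose big := [set i | #|cl i| == q.+1].
pose L := enum big ++ enum (~: big).
have LP i : i \in L by rewrite mem_cat !mem_enum in_setC orbN.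
have uL : uniq L.
  rewrite cat_uniq !enum_uniq andbT; apply/hasPn => i.
  by rewrite !mem_enum in_setC.
have sL : size L = k by rewrite size_cat -!cardE cardsC card_ord.
have cardG : #|G| = q * k + #|big|.
  rewrite -[LHS]sum1_card (partition_big c xpredT) //=.
  transitivity (\sum_(i < k) (q + (i \in big))).
    apply: eq_bigr => i _; rewrite sum1_card -[LHS]cardsE -/(cl i) inE.
    by have := sz i; rewrite -/(cl i); lia.
  rewrite big_split /= sum_nat_const card_ord mulnC; congr (_ + _).
  rewrite -sum1_card [RHS]big_mkcond; apply: eq_bigr => i _.
  by case: (i \in big).
pose idx x := index x (enum (cl (c x))).
have xcl x : x \in enum (cl (c x)) by rewrite mem_enum inE.
have idx_lt x : idx x < #|cl (c x)| by rewrite cardE index_mem.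
have lt_L i : index i L < k by rewrite -[X in _ < X]sL index_mem.
have val_lt x : idx x * k + index (c x) L < #|G|.
  rewrite cardG; have := idx_lt x; have [xb|xb] := boolP (c x \in big).
    have : index (c x) L < #|big|.
      by rewrite index_cat mem_enum xb cardE index_mem mem_enum.
    by move: xb; rewrite inE => /eqP->; nia.
  have le_q : #|cl (c x)| <= q.
    move: xb; rewrite inE => xb.
    by have /andP[_] := sz (c x); rewrite leq_eqVlt (negPf xb).
  move=> lt_idx; have le_qk : (idx x).+1 * k <= q * k.
    by rewrite leq_mul2r (leq_trans lt_idx) ?orbT.
  apply: leq_trans (leq_trans le_qk (leq_addr _ _)).
  by rewrite mulSn [k + _]addnC ltn_add2l.
pose f x : turan_graph k #|G| := Ordinal (val_lt x).
have f_mod x : f x %% k = index (c x) L by rewrite /= modnMDl modn_small.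
have L_inj : injective (fun i => index i L).
  by move=> i j e; rewrite -[i](nth_index i (LP i)) e nth_index.
have f_inj : injective f.
  move=> x y exy.
  have ec : c x = c y by apply: L_inj; rewrite /= -!f_mod exy.
  move: exy => /(congr1 val) /= /eqP.
  rewrite ec eqn_add2r eqn_pmul2r // /idx ec.
  by move=> /eqP e; rewrite -(nth_index x (xcl x)) ec e nth_index.
exists f; first by apply: inj_card_bij; rewrite // card_ord.
move=> x y; rewrite adjc -[LHS]/(f x %% k != f y %% k) !f_mod.
by rewrite (inj_eq L_inj).
Qed.

(** The first [#|M|] vertices of each class become old, a further one becomes sporadic, and
    uncoloured ones go to [Y]. Every old vertex is attained, so the complement [D] of the image is
    deletable; it has [k] elements because the extension has [#|G| + k]. *)
Lemma structured_extension M (c : G -> option 'I_k) :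
    0 < k -> k * #|M| <= #|G| -> structured [set: G] M c ->
  exists (M' : {set turan_graph k (k * #|M|)}) (D : {set ext_graph #|G| M'}),
    [/\ #|M'| = #|M|, D \subset deletable #|G| M', #|D| = k &
        isomorphic G (delete D)].
Proof.
move=> k_gt0 le_kM [cM sz adjc].
have {}adjc x y := adjc x y (in_setT x) (in_setT y).
pose cl i := class_of [set: G] c i; pose Y := [set x | c x == None].
(* Listing [M] first gives its vertices an index below [#|M|], so none becomes sporadic. *)
pose order i := enum (cl i :&: M) ++ enum (cl i :\: M).
have mem_order i x : (x \in order i) = (c x == Some i).
  by rewrite mem_cat !mem_enum !inE; case: (x \in M); case: (_ == _).
have uniq_order i : uniq (order i).
  rewrite cat_uniq !enum_uniq andbT; apply/hasPn => x.
  by rewrite !mem_enum !inE => /andP[/negPf-> _]; rewrite andbF.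
have size_order i : size (order i) = #|cl i|.
  by rewrite size_cat -!cardE cardsID.
have index_M x i : x \in M -> c x = Some i -> index x (order i) < #|M|.
  move=> xM cx; rewrite index_cat mem_enum !inE cx eqxx xM /=.
  apply: (@leq_trans #|cl i :&: M|); last exact/subset_leq_card/subsetIr.
  by rewrite cardE index_mem mem_enum !inE cx eqxx.
pose m := #|M|.
(* A relation, because the ordinal bounds need a separate proof in each case; [f] is chosen from it
   afterwards. *)
pose spec x (v : ext_vertex k #|G| m) := match v with
  | inl (inl z) => exists2 i, c x = Some i &
      index x (order i) < m /\ z = index x (order i) * k + i :> nat
  | inl (inr i) => c x = Some i /\ index x (order i) = m
  | inr y => c x = None /\ y = index x (enum Y) :> nat
  end.
have spec_ex x : exists v, spec x v.
  case cx : (c x) => [i|].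
    have : index x (order i) < m.+1.
      apply: (@leq_trans #|cl i|); last by case/andP: (sz i).
      by rewrite -size_order index_mem mem_order cx.
    rewrite ltnS leq_eqVlt => /orP[/eqP im|im]; first by exists (inl (inr i)).
    have lt_z : index x (order i) * k + i < k * m.
      by have := ltn_ord i; have : (index x (order i)).+1 * k <= m * k;
        [rewrite leq_mul2r im orbT | rewrite mulSn [k * m]mulnC; lia].
    by exists (inl (inl (Ordinal lt_z))); exists i.
  have le_Y : #|Y| <= #|G| - k * m.
    have := card_classes c; rewrite -/Y => ->.
    have : \sum_(i < k) m <= \sum_(i < k) #|cl i|.
      by apply: leq_sum => i _; case/andP: (sz i).
    by rewrite sum_nat_const card_ord -/m /cl; lia.
  have lt_y : index x (enum Y) < #|G| - k * m.
    by apply: leq_trans le_Y; rewrite cardE index_mem mem_enum inE cx.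
  by exists (inr (Ordinal lt_y)).
have [f fP] := fin_all_exists spec_ex.
have mod_z t (i : 'I_k) : (t * k + i) %% k = i by rewrite modnMDl modn_small.
have spec_inj x y v : spec x v -> spec y v -> x = y.
  case: v => [[z|i]|t] /=.
  - move=> [i cx [_ zx]] [j cy [_]]; rewrite zx => e.
    have ij : i = j.
      by apply: val_inj; rewrite /= -(mod_z (index x (order i)) i) e mod_z.
    move: e => /eqP; rewrite -ij eqn_add2r eqn_pmul2r // => /eqP e.
    by rewrite -(nth_index x (_ : x \in order i)) ?mem_order ?cx // e nth_index
      // mem_order cy ij.
  - move=> [cx ix] [cy iy].
    rewrite -(nth_index x (_ : x \in order i)) ?mem_order ?cx // ix -iy
      nth_index // mem_order cy eqxx //.
  - move=> [cx ix] [cy]; rewrite ix => e.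
    by rewrite -(nth_index x (_ : x \in enum Y)) ?mem_enum ?inE ?cx // e
      nth_index // mem_enum inE cy.
have f_inj : injective f.
  by move=> x y e; apply: (@spec_inj x y (f x)); rewrite // e.
have f_onto (z : turan_graph k (k * m)) : exists x, f x = inl (inl z).
  pose i := Ordinal (ltn_pmod z k_gt0).
  have lt_zm : z %/ k < m by rewrite ltn_divLR // [m * k]mulnC.
  have lt_zi : z %/ k < size (order i).
    by rewrite size_order (leq_trans lt_zm) //; case/andP: (sz i).
  have /card_gt0P[x0 _] : 0 < #|G| by have := ltn_ord z; lia.
  pose x := nth x0 (order i) (z %/ k).
  have cx : c x = Some i by apply/eqP; rewrite -mem_order mem_nth.
  have ix : index x (order i) = z %/ k by rewrite index_uniq.
  exists x; have := fP x.
  case: (f x) => [[z'|j]|t] /=; last by rewrite cx; case.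
    move=> [j]; rewrite cx => -[<-] [_]; rewrite ix /= -divn_eq => e.
    by congr (inl (inl _)); apply: val_inj.
  by rewrite cx => -[[<-]]; rewrite ix => e; rewrite e ltnn in lt_zm.
pose M' : {set turan_graph k (k * m)} :=
  [set z | [exists x in M, f x == inl (inl z)]].
have memM' x z : f x = inl (inl z) -> (z \in M') = (x \in M).
  move=> fx; rewrite inE; apply/exists_inP/idP => [[y yM /eqP]|xM].
    by rewrite -fx => /f_inj <-.
  by exists x; rewrite ?fx.
have fM x : x \in M -> exists z, f x = inl (inl z).
  move=> xM; have := fP x; case: (f x) => [[z|i]|t] /=.
  - by exists z.
  - by move=> [cx]; have := index_M x i xM cx => + e; rewrite e ltnn.
  - by move=> [cx]; have := cM x xM; rewrite cx.
exists M'; pose D : {set ext_graph #|G| M'} := ~: [set f x | x in G].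
have memD x : (f x \in ~: D) by rewrite setCK imset_f.
have cardf : #|~: D| = #|G| by rewrite setCK card_imset.
exists D; split.
- have [g gP] := fin_all_exists f_onto.
  have g_inj : injective g by move=> z z' e; have := gP z; rewrite e gP => -[].
  rewrite -(card_imset _ g_inj); apply: eq_card => x; apply/imsetP/idP.
    by move=> [z zM ->]; rewrite -(memM' _ z).
  move=> xM; have [z fx] := fM x xM; exists z; first by rewrite (memM' x).
  by apply: f_inj; rewrite gP.
- apply/subsetP => -[[z|i]|t]; rewrite !inE //.
  by have [x <-] := f_onto z; rewrite imset_f.
- have := cardsC D; rewrite cardf !card_sum !card_ord -/m.
  rewrite -/m in le_kM; lia.
- pose h x : delete D := exist _ (f x) (memD x).
  have h_inj : injective h by move=> x y [] /f_inj.
  exists h.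
    apply: (inj_card_bij h_inj); rewrite card_sig; apply: eq_leq.
    by rewrite -[RHS]cardf; apply: eq_card.
  move=> x y; rewrite -[LHS]/(@ext_adj k #|G| m M' (f x) (f y)) adjc.
  have notM t i : f t = inl (inr i) -> t \notin M.
    by move=> ft; apply/negP => /fM[z]; rewrite ft.
  have := fP x; have := fP y.
  case fx : (f x) => [[z|i]|t]; case fy : (f y) => [[z'|j]|t'] /=.
  + move=> [j -> [_ e']] [i -> [_ e]].
    by rewrite -[LHS]/(z %% k != z' %% k) e e' !mod_z.
  + move=> [-> _] [i -> [_ e]]; by rewrite inE e mod_z.
  + by move=> [-> _] [i -> _]; rewrite (memM' x).
  + by move=> [j' -> [_ e]] [-> _]; rewrite inE e mod_z eq_sym.
  + by move=> [-> _] [-> _].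
  + by move=> [-> _] [-> _]; rewrite (notM x i).
  + by move=> [j -> _] [-> _]; rewrite (memM' y).
  + by move=> [-> _] [-> _]; rewrite (notM y j).
  + by move=> [-> _] [-> _]; rewrite -(inj_eq f_inj) fx fy.
Qed.

End Isomorphisms.

(** * The two ranges of [n], with their cases of equality *)

Theorem theorem1p2 (r n m : nat) (G : sgraph) (M : {set G})
    (r_ge3 : 3 <= r) (m_le_n : m <= n) (cardG : #|G| = n) (cardM : #|M| = m)
    (noKr : ~ exists K : {set G}, [/\ clique K, #|K| = r & K :&: M != set0]) :
  num_edges G <= turan_bound r.-1 n m /\
  (num_edges G = turan_bound r.-1 n m -> turan_family r.-1 n m G).
Proof.
case: r r_ge3 noKr => // k; rewrite ltnS => k_gt1 noKr /=.
have k_gt0 : 0 < k by apply: ltnW.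
have nK : no_clique_meets k M.
  move=> K cK kK; rewrite -setI_eq0; apply: contraT => KM.
  by case: noKr; exists K.
have eG := num_edges_non_weight G; have cT : #|[set: G]| = n by rewrite cardsT.
rewrite cardG in eG.
rewrite /turan_bound /turan_family; case: (leqP n (k * m)) => [le_nkm|lt_kmn].
  pose q := n %/ k.
  have le_qm : q <= m by have := leq_div2r k le_nkm; rewrite mulKn.
  have [|M' sM' cM'] := @subset_of_card G M q; first by rewrite cardM.
  have nK' := no_clique_meetsS sM' nK.
  have le_kq : k * q <= n by rewrite mulnC leq_divM.
  have := @non_weight_lb G k [set: G] M' k_gt0 nK' (subsetT _).
  rewrite cT cM' => /(_ le_kq) lb.
  have eT := num_edges_non_weight (turan_graph k n).
  rewrite turan_non_weight // card_ord -/(turan_number k n) -/q in eT.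
  (* The Turan graph has equality in [non_weight_lb] for [#|M'| = q]. *)
  have eW : k * q ^ 2 + n %% k * (2 * q).+1 + k * q * q.+1 = 2 * n * q + n.
    by rewrite [in RHS](divn_eq n k) -/q; nia.
  split=> [|eq_e]; first by lia.
  have ex : extremal k [set: G] M' by split; rewrite ?cT ?cM' ?subsetT //; lia.
  have [c strc] := extremal_structured k_gt0 ex.
  have [||c' bal] := structured_balanced k_gt1 nK sM' cM' strc;
    rewrite ?cardG //.
    (* [k * q < n <= k * m] forces [q < m], so [M] has a vertex outside [M']. *)
    move=> lt_kq; apply/subsetPn; apply/negP => /subset_leq_card.
    by rewrite cM' cardM; nia.
  by rewrite -cardG; apply: balanced_turan bal.
have := @non_weight_lb G k [set: G] M k_gt0 nK (subsetT _).
rewrite cT cardM => /(_ (ltnW lt_kmn)) lb.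
have eC := bin2_double n; have eCm := bin2_double m.+1.
(* With [1 < k] and [k * m < n], the subtraction in [turan_bound] does not truncate. *)
have le_nm : n * m <= 'C(n, 2) by nia.
have ekm : 2 * (k * 'C(m.+1, 2)) = k * m * m.+1 by nia.
split=> [|eq_e]; first by lia.
have ex : extremal k [set: G] M.
  by split; rewrite ?cT ?cardM ?subsetT //; lia.
have [c strc] := extremal_structured k_gt0 ex.
have := structured_extension k_gt0 _ strc.
by rewrite cardG cardM; apply; apply: ltnW.
Qed.
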